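(* Let $\tau>0$ and let $\Gamma_h^m$ be a closed triangulated surface in $\mathbb{R}^3$. Suppose that $$(v_h^{m+1},H_h^{m+1},\lambda_h^{m+1},\kappa_h^{m+1})\in S_h(\Gamma_h^m)^3\times S_h(\Gamma_h^m)\times S_h(\Gamma_h^m)^3\times S_h(\Gamma_h^m)$$ is a solution of one of the following two numerical schemes. (MCF, mean curvature flow) For all $(w_h,\phi_h,\eta_h,\varphi_h)\in S_h(\Gamma_h^m)^3\times S_h(\Gamma_h^m)\times S_h(\Gamma_h^m)^3\times S_h(\Gamma_h^m)$: $$-\int_{\Gamma_h^m}^{(h)}H_h^{m+1}n_h^m\cdot w_h+\int_{\Gamma_h^m}\nabla_{\Gamma_h^m}(\mathrm{id}+\tau v_h^{m+1})\cdot\nabla_{\Gamma_h^m}w_h=\int_{\Gamma_h^m}\nabla_{\Gamma_h^m}\lambda_h^{m+1}\cdot\nabla_{\Gamma_h^m}w_h,$$ $$\int_{\Gamma_h^m}^{(h)}(v_h^{m+1}\cdot n_h^m)\phi_h+\int_{\Gamma_h^m}^{(h)}H_h^{m+1}\phi_h=0,$$ $$\int_{\Gamma_h^m}\nabla_{\Gamma_h^m}v_h^{m+1}\cdot\nabla_{\Gamma_h^m}\eta_h=\int_{\Gamma_h^m}^{(h)}\kappa_h^{m+1}n_h^m\cdot\eta_h,$$ $$\int_{\Gamma_h^m}^{(h)}\lambda_h^{m+1}\cdot n_h^m\,\varphi_h=0 .$$ (SD, surface diffusion) The same system with the second equation replaced by $$\int_{\Gamma_h^m}^{(h)}(v_h^{m+1}\cdot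 n_h^m)\phi_h+\int_{\Gamma_h^m}\nabla_{\Gamma_h^m}H_h^{m+1}\cdot\nabla_{\Gamma_h^m}\phi_h=0 .$$ Let $\Gamma_h^{m+1}:=X_h^{m+1}(\Gamma_h^m)$ with $X_h^{m+1}=\mathrm{id}+\tau v_h^{m+1}$. Then, for either scheme, $$|\Gamma_h^{m+1}|\le|\Gamma_h^m| .$$
   Context: A closed triangulated surface $\Gamma_h^m=\bigcup_{K\in\mathcal{K}_h^m}K\subset\mathbb{R}^3$ is a polyhedral surface without boundary that is the union of the finite set $\mathcal{K}_h^m$ of (flat, conforming, nondegenerate) triangles, oriented so that the vertices $q_{K,0},q_{K,1},q_{K,2}$ of each $K$ are ordered counterclockwise as seen from the exterior. $|K|$ is the area of $K$. $n_h^m$ is the piecewise-constant unit normal vector on $\Gamma_h^m$ (constant on each triangle). Finite element space: $S_h(\Gamma_h^m)=\{v_h\in C^0(\Gamma_h^m): v_h|_K\text{ is affine for all }K\in\mathcal{K}_h^m\}$; $S_h(\Gamma_h^m)^3$ is its vector-valued version. Mass-lumped integral: for (possibly discontinuous across elements) piecewise-defined $u,w$, $$\int_{\Gamma_h^m}^{(h)}u\cdot w:=\sum_{K\in\mathcal{K}_h^m}\frac{|K|}{3}\sum_{j=0}^2 (u\cdot w)|_K(q_{K,j}).$$ $\nabla_{\Gamma_h^m}$ is the elementwise surface (tangential) gradient on $\Gamma_h^m$, applied componentwise to vector-valued functions, and the dot between gradients of vector fields is the Frobenius inner product. $\mathrm{id}(x)=x$ on $\Gamma_h^m$. $|\Gamma_h^m|=\sum_{K\in\mathcal{K}_h^m}|K|$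 is the discrete surface area; $\Gamma_h^{m+1}$ is regarded as the triangulated surface with triangles $X_h^{m+1}(K)$, $K\in\mathcal{K}_h^m$, and $|\Gamma_h^{m+1}|=\sum_{K\in\mathcal{K}_h^m}|X_h^{m+1}(K)|$. *)

(* Defs.v *)
From HB Require Import structures.
From mathcomp Require Import all_boot all_order all_algebra.
From mathcomp Require Import all_classical all_reals all_analysis.

Set Implicit Arguments.
Unset Strict Implicit.
Unset Printing Implicit Defensive.

Import Order.TTheory GRing.Theory Num.Theory.
Import numFieldNormedType.Exports.

Local Open Scope classical_set_scope.
Local Open Scope ring_scope.

Section Geometry.
Context {R : realType}.
Implicit Types (u v w : 'rV[R]_3) (q : 'I_3 -> 'rV[R]_3).

Definition dot u v : R := \sum_(i < 3) u 0 i * v 0 i.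

(* The Euclidean norm; the library norm on 'rV[R]_3 is the sup norm. *)
Definition enorm u : R := Num.sqrt (dot u u).

(* Indices are added in 'I_3, that is, modulo 3. *)
Definition cross u v : 'rV[R]_3 :=
  \row_(i < 3) (u 0 (i + 1) * v 0 (i + 2) - u 0 (i + 2) * v 0 (i + 1)).

(* Convex hull of those vertices [q j] for which [P j]. *)
Definition face q (P : pred 'I_3) : set 'rV[R]_3 :=
  [set x | exists b : 'I_3 -> R,
    [/\ forall j, 0 <= b j, forall j, ~~ P j -> b j = 0,
        \sum_j b j = 1 & x = \sum_j b j *: q j]].

Definition triangle q : set 'rV[R]_3 := face q xpredT.

Definition relint_triangle q : set 'rV[R]_3 :=
  [set x | exists b : 'I_3 -> R,
    [/\ forall j, 0 < b j, \sum_j b j = 1 & x = \sum_j b j *: q j]].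

Definition tri_cross q : 'rV[R]_3 := cross (q 1 - q 0) (q 2 - q 0).

Definition tri_area q : R := enorm (tri_cross q) / 2.

(* The unit normal from whose side [q 0, q 1, q 2] runs counterclockwise. *)
Definition tri_normal q : 'rV[R]_3 := (enorm (tri_cross q))^-1 *: tri_cross q.

Definition is_vertex q (p : 'rV[R]_3) : bool := [exists j, q j == p].

Definition ref_triangle : set (R * R) :=
  [set s | [/\ 0 < s.1, 0 < s.2 & s.1 + s.2 < 1]].

Definition tri_param q (s : R * R) : 'rV[R]_3 :=
  q 0 + s.1 *: (q 1 - q 0) + s.2 *: (q 2 - q 0).

(* Surface integral over the triangle, pulled back along the affine
   parametrisation, whose area element is the constant [2 * tri_area q].  The
   edges, a null set, are left out: elementwise derivatives are only meaningful
   in the relative interior. *)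
Definition tri_integral q (f : 'rV[R]_3 -> R) : R :=
  2 * tri_area q *
  \int[(@lebesgue_measure R \x @lebesgue_measure R)%E]_(s in ref_triangle)
     f (tri_param q s).

Definition tangent_proj q u : 'rV[R]_3 :=
  u - dot u (tri_normal q) *: tri_normal q.

(* The i-th coordinate of the tangential gradient of [f] is the derivative of
   [f] in the direction of the tangential part of the i-th unit vector.  At a
   point of the relative interior of the triangle this only involves values of
   [f] on the triangle. *)
Definition tgrad q (f : 'rV[R]_3 -> R) (x : 'rV[R]_3) : 'rV[R]_3 :=
  \row_(i < 3) 'D_(tangent_proj q (delta_mx 0 i)) f x.

Definition tgrad_dot q (f g : 'rV[R]_3 -> R) (x : 'rV[R]_3) : R :=
  dot (tgrad q f x) (tgrad q g x).

(* The Frobenius product of the componentwise gradients. *)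
Definition tgrad_dotv q (f g : 'rV[R]_3 -> 'rV[R]_3) (x : 'rV[R]_3) : R :=
  \sum_(k < 3) tgrad_dot q (fun y => f y 0 k) (fun y => g y 0 k) x.

Definition affine_on (A : set 'rV[R]_3) (f : 'rV[R]_3 -> R) : Prop :=
  exists (c : R) (g : 'rV[R]_3), forall x, A x -> f x = c + dot g x.

End Geometry.

(* [vtx K] lists the vertices of the triangle K in the order of its orientation.
   - [surf_conform]: two distinct triangles meet exactly in the convex hull of
     their common vertices, i.e. in nothing, a vertex or an edge (they cannot
     have all three vertices in common, by [surf_inj]).
   - [surf_edge]: the edge of K opposite to its vertex j lies in exactly one
     other triangle, so that there is no boundary.
   - [surf_star]: the triangles around a vertex p are connected through edges
     containing p, so that with [surf_edge] the union is a 2-manifold at p.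
   - [surf_exterior]: the surface bounds a bounded open set [Omega], and the
     orientation normal of each triangle points from [Omega] to the exterior of
     the surface, the complement of the closure of [Omega]. *)
Record closed_surface (R : realType) := ClosedSurface {
  cell : finType;
  vtx : cell -> 'I_3 -> 'rV[R]_3;
  surf : set 'rV[R]_3 := \bigcup_(K in [set: cell]) triangle (vtx K);
  surf_nondeg : forall K, 0 < tri_area (vtx K);
  surf_inj : forall K L, triangle (vtx K) = triangle (vtx L) -> K = L;
  surf_conform : forall K L, K != L ->
    triangle (vtx K) `&` triangle (vtx L) =
    face (vtx K) (fun j => is_vertex (vtx L) (vtx K j));
  surf_edge : forall K j, exists! L,
    L != K /\ forall i, i != j -> is_vertex (vtx L) (vtx K i);
  surf_star : forall p K L, is_vertex (vtx K) p -> is_vertex (vtx L) p ->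
    connect [rel K1 K2 | [&& is_vertex (vtx K1) p, is_vertex (vtx K2) p &
      [exists j, (vtx K1 j != p) && is_vertex (vtx K2) (vtx K1 j)]]] K L;
  surf_exterior : exists Omega : set 'rV[R]_3,
    [/\ open Omega, bounded_set Omega, closure Omega `\` Omega = surf &
      forall K x, relint_triangle (vtx K) x ->
        \forall t \near (0 : R)^'+,
          Omega (x - t *: tri_normal (vtx K)) /\
          ~ closure Omega (x + t *: tri_normal (vtx K))]
}.

Section FiniteElements.
Context {R : realType} (G : closed_surface R).
Implicit Types (f : 'rV[R]_3 -> R) (u v w : 'rV[R]_3 -> 'rV[R]_3).

Definition nrm (K : cell G) : 'rV[R]_3 := tri_normal (vtx K).

(* Functions on the surface are represented by total functions on R^3; only
   their values on the surface are ever used. *)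
Definition Sh f : Prop :=
  {within surf G, continuous f} /\
  forall K : cell G, affine_on (triangle (vtx K)) f.

Definition Sh3 v : Prop := forall k : 'I_3, Sh (fun x => v x 0 k).

(* In both integrals [F K] is the restriction of the integrand to K. *)
Definition lumped (F : cell G -> 'rV[R]_3 -> R) : R :=
  \sum_(K : cell G) tri_area (vtx K) / 3 * \sum_(j < 3) F K (vtx K j).

Definition surf_integral (F : cell G -> 'rV[R]_3 -> R) : R :=
  \sum_(K : cell G) tri_integral (vtx K) (F K).

Definition dirichlet f g : R :=
  surf_integral (fun K => tgrad_dot (vtx K) f g).

Definition dirichletv v w : R :=
  surf_integral (fun K => tgrad_dotv (vtx K) v w).

Definition flow_map (tau : R) v (x : 'rV[R]_3) : 'rV[R]_3 := x + tau *: v x.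

Definition curvature_eq tau v H lam : Prop := forall w, Sh3 w ->
  - lumped (fun K x => dot (H x *: nrm K) (w x)) + dirichletv (flow_map tau v) w
  = dirichletv lam w.

Definition mcf_velocity_eq v H : Prop := forall phi, Sh phi ->
  lumped (fun K x => dot (v x) (nrm K) * phi x)
  + lumped (fun K x => H x * phi x) = 0.

Definition sd_velocity_eq v H : Prop := forall phi, Sh phi ->
  lumped (fun K x => dot (v x) (nrm K) * phi x) + dirichlet H phi = 0.

Definition tangential_eq v kappa : Prop := forall eta, Sh3 eta ->
  dirichletv v eta = lumped (fun K x => dot (kappa x *: nrm K) (eta x)).

Definition multiplier_eq lam : Prop := forall phi, Sh phi ->
  lumped (fun K x => dot (lam x) (nrm K) * phi x) = 0.

Definition mcf_scheme tau v H lam kappa : Prop :=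
  [/\ curvature_eq tau v H lam, mcf_velocity_eq v H,
      tangential_eq v kappa & multiplier_eq lam].

Definition sd_scheme tau v H lam kappa : Prop :=
  [/\ curvature_eq tau v H lam, sd_velocity_eq v H,
      tangential_eq v kappa & multiplier_eq lam].

Definition surf_area : R := \sum_(K : cell G) tri_area (vtx K).

(* Area of the image surface with triangles [X @` triangle (vtx K)]; see
   [image_triangle]. *)
Definition image_area (X : 'rV[R]_3 -> 'rV[R]_3) : R :=
  \sum_(K : cell G) tri_area (X \o vtx K).

Lemma dot_sumr (u : 'rV[R]_3) (b : 'I_3 -> R) (q : 'I_3 -> 'rV[R]_3) :
  dot u (\sum_j b j *: q j) = \sum_j b j * dot u (q j).
Proof.
rewrite /dot; under eq_bigr do rewrite summxE mulr_sumr.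
rewrite exchange_big /=; apply: eq_bigr => j _; rewrite mulr_sumr.
by apply: eq_bigr => i _; rewrite mxE mulrCA.
Qed.

Lemma image_triangle tau v (K : cell G) : Sh3 v ->
  flow_map tau v @` triangle (vtx K) = triangle (flow_map tau v \o vtx K).
Proof.
move=> vS.
have vtxK j : triangle (vtx K) (vtx K j).
  exists (fun i => (i == j)%:R); split=> //.
  - rewrite (bigD1 j) //= eqxx big1 ?addr0 //.
    by move=> i /negbTE ->.
  - rewrite (bigD1 j) //= eqxx scale1r big1 ?addr0 //.
    by move=> i /negbTE ->; rewrite scale0r.
have E b : (forall j, 0 <= b j) -> \sum_j b j = 1 ->
    flow_map tau v (\sum_j b j *: vtx K j) =
    \sum_j b j *: flow_map tau v (vtx K j).
  move=> b0 b1; rewrite /flow_map.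
  under [RHS]eq_bigr do rewrite scalerDr.
  rewrite big_split /=; congr (_ + _).
  apply/rowP => k; rewrite mxE summxE.
  have [c [g vE]] := (vS k).2 K.
  rewrite (vE (\sum_j b j *: vtx K j)); last by exists b.
  rewrite dot_sumr -[c]mul1r -b1 mulr_suml -big_split mulr_sumr /=.
  by apply: eq_bigr => j _; rewrite !mxE -mulrDr -(vE _ (vtxK j)) mulrCA.
apply/seteqP; split=> [_ [_ [b [b0 bP b1 ->]] <-]|_ [b [b0 bP b1 ->]]].
  by exists b; split=> //; rewrite E.
by exists (\sum_j b j *: vtx K j); [exists b | rewrite E].
Qed.

End FiniteElements.

(* Main.v *)
(* Write X = id + tau v.  Testing the curvature equation with v, the tangential
   equation with lambda, the multiplier equation with kappa and the velocity
   equation with H gives D(X, v) = (H n, v)_h <= 0 for the Dirichlet form D.  Hence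
   0 >= tau D(X, v) = D(X, X - id) >= D(X, X) / 2 - D(id, id) / 2.  On each triangle
   the Dirichlet energy D(X, X) / 2 is at least the area of the image, with equality
   for X = id; for affine maps this is AM-GM for the Gram matrix of the edges. *)

Require Import Defs.
From mathcomp Require Import all_boot all_order all_algebra.
From mathcomp Require Import all_classical all_reals all_analysis.
From mathcomp Require Import measurable_realfun ring lra.

Set Implicit Arguments.
Unset Strict Implicit.
Unset Printing Implicit Defensive.

Import Order.TTheory GRing.Theory Num.Theory.
Import numFieldNormedType.Exports.

Local Open Scope classical_set_scope.
Local Open Scope ring_scope.

(** * Vector algebra in R^3 *)

Lemma sum_ord3 (V : nmodType) (F : 'I_3 -> V) : \sum_(i < 3) F i = F 0 + F 1 + F 2.
Proof.
rewrite !big_ord_recl big_ord0 addr0 addrA.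
by congr (_ + F _ + F _); apply: val_inj.
Qed.

Lemma forall_ord3 (P : 'I_3 -> Prop) : P 0 -> P 1 -> P 2 -> forall i, P i.
Proof.
move=> P0 P1 P2 [[|[|[|//]]] ?].
- by rewrite (_ : Ordinal _ = 0) //; apply: val_inj.
- by rewrite (_ : Ordinal _ = 1) //; apply: val_inj.
- by rewrite (_ : Ordinal _ = 2) //; apply: val_inj.
Qed.

Section Vectors.
Context {R : realType}.
Implicit Types (u v w p x : 'rV[R]_3) (q : 'I_3 -> 'rV[R]_3).

Lemma dotE u v : dot u v = u 0 0 * v 0 0 + u 0 1 * v 0 1 + u 0 2 * v 0 2.
Proof. exact: sum_ord3. Qed.

Lemma crossE u v :
  ((cross u v 0 0 = u 0 1 * v 0 2 - u 0 2 * v 0 1) *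
  (cross u v 0 1 = u 0 2 * v 0 0 - u 0 0 * v 0 2) *
  (cross u v 0 2 = u 0 0 * v 0 1 - u 0 1 * v 0 0))%type.
Proof.
have E11 : 1 + 1 = 2 :> 'I_3 by apply: val_inj.
have E12 : 1 + 2 = 0 :> 'I_3 by apply: val_inj.
have E21 : 2 + 1 = 0 :> 'I_3 by apply: val_inj.
have E22 : 2 + 2 = 1 :> 'I_3 by apply: val_inj.
by rewrite !mxE !add0r E11 E12 E21 E22.
Qed.

Lemma dotC u v : dot u v = dot v u.
Proof. by rewrite !dotE; ring. Qed.

Lemma dotDl u v w : dot (u + v) w = dot u w + dot v w.
Proof. by rewrite !dotE !mxE; ring. Qed.

Lemma dotZl a u w : dot (a *: u) w = a * dot u w.
Proof. by rewrite !dotE !mxE; ring. Qed.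

Lemma dotBl u v w : dot (u - v) w = dot u w - dot v w.
Proof. by rewrite !dotE !mxE; ring. Qed.

Lemma dotDr u v w : dot w (u + v) = dot w u + dot w v.
Proof. by rewrite !dotE !mxE; ring. Qed.

Lemma dotZr a u w : dot w (a *: u) = a * dot w u.
Proof. by rewrite !dotE !mxE; ring. Qed.

Lemma dotBr u v w : dot w (u - v) = dot w u - dot w v.
Proof. by rewrite !dotE !mxE; ring. Qed.

Lemma dot_delta u i : dot u (delta_mx 0 i) = u 0 i.
Proof.
rewrite /dot (bigD1 i) //= mxE !eqxx mulr1 big1 ?addr0 // => j /negbTE ji.
by rewrite mxE ji mulr0.
Qed.

Lemma dot_ge0 u : 0 <= dot u u.
Proof. by apply: sumr_ge0 => i _; exact: sqr_ge0. Qed.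

Lemma enorm_sqr u : enorm u ^+ 2 = dot u u.
Proof. by rewrite sqr_sqrtr ?dot_ge0. Qed.

Lemma enorm_ge0 u : 0 <= enorm u. Proof. exact: sqrtr_ge0. Qed.

Lemma dot_cross_l u v : dot u (cross u v) = 0.
Proof. by rewrite dotE !crossE; ring. Qed.

Lemma dot_cross_r u v : dot v (cross u v) = 0.
Proof. by rewrite dotE !crossE; ring. Qed.

Lemma cross_sqr u v :
  dot (cross u v) (cross u v) = dot u u * dot v v - dot u v ^+ 2.
Proof. by rewrite !dotE !crossE; ring. Qed.

(* The Gram determinant of [u], [v], [p] is the squared triple product. *)
Lemma gram_cross u v p : dot p (cross u v) = 0 ->
  dot p p * dot (cross u v) (cross u v) =
  dot v v * dot p u ^+ 2 - 2 * dot u v * (dot p u * dot p v)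
  + dot u u * dot p v ^+ 2.
Proof.
move=> p0; apply/eqP; rewrite -subr_eq0; apply/eqP.
transitivity (dot p (cross u v) ^+ 2); last by rewrite p0 expr0n.
by rewrite !dotE !crossE; ring.
Qed.

(** Cramer's rule in the plane of [u] and [v], cleared of the denominator |u x v|^2. *)
Lemma cross_span u v p : dot p (cross u v) = 0 ->
  dot (cross u v) (cross u v) *: p =
  dot (cross p v) (cross u v) *: u + dot (cross u p) (cross u v) *: v.
Proof.
move=> p0; apply/rowP => i; apply/eqP; rewrite -subr_eq0; apply/eqP.
(* For arbitrary [p] the two sides differ by the normal part (p . N) N, where N = u x v. *)
transitivity (dot p (cross u v) * cross u v 0 i); last by rewrite p0 mul0r.
by move: i; apply: forall_ord3; rewrite !(dotE, crossE, mxE); ring.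
Qed.

(* Times [|u|^2], the right-hand side is [|S|^2 + |u x v|^2 |a|^2] with
   [S = |u|^2 b - (u.v) a], and [|u|^2 |a x b| = |a x S| <= |a| |S|]. *)
Lemma cross_am_gm u v a b : 0 < enorm (cross u v) ->
  2 * enorm (cross u v) * enorm (cross a b) <=
  dot v v * dot a a - 2 * dot u v * dot a b + dot u u * dot b b.
Proof.
move=> W0.
have u0 : 0 < dot u u.
  rewrite lt_neqAle dot_ge0 andbT; apply/negP => /eqP u0.
  have := exprn_gt0 2 W0; rewrite enorm_sqr cross_sqr -u0 mul0r sub0r.
  by rewrite oppr_gt0 ltNge sqr_ge0.
rewrite -(ler_pM2l u0).
set S := dot u u *: b - dot u v *: a.
have SE : dot u u * (dot v v * dot a a - 2 * dot u v * dot a b + dot u u * dot b b)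
    = dot S S + dot (cross u v) (cross u v) * dot a a.
  by rewrite cross_sqr /S !(dotBl, dotBr, dotZl, dotZr) (dotC b a); ring.
have NE : (dot u u * (2 * enorm (cross u v) * enorm (cross a b))) ^+ 2 =
    4 * dot (cross u v) (cross u v) * (dot S S * dot a a - dot a S ^+ 2).
  rewrite !exprMn !enorm_sqr (cross_sqr a).
  by rewrite /S !(dotBl, dotBr, dotZl, dotZr) (dotC b a); ring.
rewrite SE -ler_sqr ?nnegrE ?NE.
(* AM-GM for X = |S|^2 and Y = |u x v|^2 |a|^2, in the form 4 X Y <= (X + Y)^2; the term with (a .
   S)^2 only helps. *)
- have := sqr_ge0 (dot S S - dot (cross u v) (cross u v) * dot a a).
  have : 0 <= dot (cross u v) (cross u v) * dot a S ^+ 2.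
    by rewrite mulr_ge0 ?dot_ge0 ?sqr_ge0.
  by lra.
- by rewrite !mulr_ge0 ?enorm_ge0 // ltW.
- by rewrite addr_ge0 ?mulr_ge0 ?dot_ge0.
Qed.

(** * Tangential gradients of affine functions *)

Lemma near0_affine_gt0 (y a : R) : 0 < y -> \forall h \near 0^', 0 < y + h * a.
Proof.
move=> y0; apply: cvg_within.
have /cvgr_gt : (fun h : R => y + h * a) @ 0 --> y + 0 * a.
  by apply: cvgD; [exact: cvg_cst|apply: cvgM; [exact: cvg_id|exact: cvg_cst]].
by apply; rewrite mul0r addr0.
Qed.

Lemma enorm_tri_cross_gt0 q : 0 < tri_area q -> 0 < enorm (tri_cross q).
Proof. by rewrite /tri_area pmulr_lgt0 ?invr_gt0. Qed.

(** Moving orthogonally to the normal stays in the plane of the triangle, and a short move from an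
    interior point stays in the triangle. There the difference quotient is constant, so values of
    [f] elsewhere do not matter. *)
Lemma derive_affine_on q (f : 'rV[R]_3 -> R) (c : R) g w s :
  (forall x, triangle q x -> f x = c + dot g x) ->
  0 < tri_area q -> dot w (tri_cross q) = 0 -> ref_triangle s ->
  'D_w f (tri_param q s) = dot g w.
Proof.
move=> fE A0 w0 [s1 s2 s12].
rewrite /derive; apply: lim_near_cst => //.
have [a [b wE]] : exists a b, w = a *: (q 1 - q 0) + b *: (q 2 - q 0).
  have n0 : dot (tri_cross q) (tri_cross q) != 0.
    by rewrite -enorm_sqr expf_neq0 // lt0r_neq0 // enorm_tri_cross_gt0.
  exists ((dot (tri_cross q) (tri_cross q))^-1 * dot (cross w (q 2 - q 0)) (tri_cross q)).
  exists ((dot (tri_cross q) (tri_cross q))^-1 * dot (cross (q 1 - q 0) w) (tri_cross q)).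
  by rewrite -!scalerA -scalerDr -(cross_span w0) scalerA mulVf // scale1r.
have triP (t1 t2 : R) : 0 <= t1 -> 0 <= t2 -> t1 + t2 <= 1 -> triangle q (tri_param q (t1, t2)).
  move=> t10 t20 t12.
  exists (fun j : 'I_3 => if j == 0 then 1 - t1 - t2 else if j == 1 then t1 else t2).
  split=> //.
  - by apply: forall_ord3 => //=; lra.
  - by rewrite sum_ord3 /=; ring.
  - rewrite sum_ord3 /tri_param /=; apply/rowP => i; rewrite !mxE; ring.
have moveE h : h *: w + tri_param q s = tri_param q (s.1 + h * a, s.2 + h * b).
  by rewrite wE /tri_param /=; apply/rowP => i; rewrite !mxE; ring.
have fs : f (tri_param q s) = c + dot g (tri_param q s).
  by rewrite fE //; case: s s1 s2 s12 {moveE} => t1 t2 /= *; apply: triP; lra.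
near=> h.
have h0 : h != 0 by near: h; exact: nbhs_dnbhs_neq.
rewrite /= fE ?fs; last first.
  rewrite moveE; apply: triP.
  - by apply: ltW; near: h; exact: near0_affine_gt0.
  - by apply: ltW; near: h; exact: near0_affine_gt0.
  (* The barycentric coordinate at [q 0] changes at rate - a - b. *)
  - suff : 0 < 1 - s.1 - s.2 + h * (- a - b) by lra.
    by near: h; apply: near0_affine_gt0; lra.
rewrite dotDr dotZr (_ : _ - _ = h * dot g w); last by ring.
by rewrite /GRing.scale /= mulrA mulVf ?mul1r.
Unshelve. all: by end_near.
Qed.

(** The tangential projection is symmetric, so pairing [g] with the projected i-th unit vector gives
    the i-th coordinate of the projected [g]. *)
Lemma tgrad_affine_on q (f : 'rV[R]_3 -> R) (c : R) g s :
  (forall x, triangle q x -> f x = c + dot g x) ->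
  0 < tri_area q -> ref_triangle s ->
  tgrad q f (tri_param q s) = tangent_proj q g.
Proof.
move=> fE A0 sP; apply/rowP => i; rewrite mxE.
have /lt0r_neq0 e0 := enorm_tri_cross_gt0 A0.
rewrite (derive_affine_on fE) //.
- rewrite /tangent_proj dotBr dotZr dot_delta (dotC (delta_mx _ _)) dot_delta !mxE.
  by rewrite mulrC.
- rewrite /tangent_proj /tri_normal dotBl !dotZl !dotZr -enorm_sqr dotC.
  by field.
Qed.

End Vectors.


(** * Measure of the reference triangle *)

Lemma measurable_ref_triangle (R : realType) : measurable (@ref_triangle R).
Proof.
have mlt (f g : R * R -> R) : measurable_fun setT f -> measurable_fun setT g ->
    measurable [set s | f s < g s].
  move=> mf mg.
  have := measurable_fun_ltr mf mg measurableT (I : measurable [set true]).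
  by rewrite setTI.
rewrite (_ : ref_triangle = [set s : R * R | 0 < s.1] `&` [set s | 0 < s.2]
    `&` [set s | s.1 + s.2 < 1]); last first.
  by apply/seteqP; split=> s [] //= [].
by apply: measurableI; [apply: measurableI|]; apply: mlt => //;
  exact: measurable_funD.
Qed.

Lemma lebesgue_measure_square (R : realType) (b : R) : 0 < b ->
  (@lebesgue_measure R \x @lebesgue_measure R)%E
    (`]0, b[%classic `*` `]0, b[%classic) = (b * b)%:E.
Proof.
move=> b0; rewrite product_measure1E //.
have E : lebesgue_measure (`]0, b[%classic : set R) = b%:E.
  by rewrite lebesgue_measure_itv /= lte_fin b0 -EFinD subr0.
by rewrite EFinM; congr (_ * _)%E; exact: E.
Qed.

(** The triangle lies between the squares of side 1/2 and 1. The outer one gives finiteness, needed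
    because [fine] sends an infinite measure to 0. *)
Lemma ref_triangle_measure_gt0 (R : realType) :
  0 < fine ((@lebesgue_measure R \x @lebesgue_measure R)%E (@ref_triangle R)).
Proof.
have mS (b : R) : measurable (`]0, b[%classic `*` `]0, b[%classic : set (R * R)).
  exact: measurableX.
apply: fine_gt0; apply/andP; split.
  apply: (@lt_le_trans _ _ ((2^-1 : R) * 2^-1)%:E).
    by rewrite lte_fin; lra.
  rewrite -lebesgue_measure_square ?invr_gt0 //.
  apply: le_measure; rewrite ?inE; [exact: mS|exact: measurable_ref_triangle|].
  by move=> [s t] [] /=; rewrite !in_itv /= => /andP[? ?] /andP[? ?]; split => /=; lra.
apply: (@le_lt_trans _ _ ((1 : R) * 1)%:E); last by rewrite ltry.
rewrite -lebesgue_measure_square //.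
apply: le_measure; rewrite ?inE; [exact: measurable_ref_triangle|exact: mS|].
by move=> [s t] [] /= *; rewrite !in_itv /=; lra.
Qed.

(** * Area and Dirichlet energy on one triangle *)

Section Elements.
Context {R : realType}.
Implicit Types (q : 'I_3 -> 'rV[R]_3) (u v w : 'rV[R]_3 -> 'rV[R]_3).

(* Equal to 1/2, but it factors out of every integral, so [0 < m] is enough. *)
Local Notation m :=
  (fine ((@lebesgue_measure R \x @lebesgue_measure R)%E (@ref_triangle R))).

(** Evaluates the Dirichlet integrals: gradients of affine functions are constant on each open
    triangle. *)
Lemma tri_integral_cst q (F : 'rV[R]_3 -> R) r :
  (forall s, ref_triangle s -> F (tri_param q s) = r) ->
  tri_integral q F = m * (2 * tri_area q * r).
Proof.
move=> Fr; rewrite /tri_integral.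
rewrite (@eq_Rintegral _ _ _ _ _ (cst r)) => [|s]; last first.
  by rewrite inE => /Fr.
by rewrite Rintegral_cst ?mulrA; [ring|exact: measurable_ref_triangle].
Qed.

Definition affine_with q (c : 'I_3 -> R) (g : 'I_3 -> 'rV[R]_3) v :=
  forall k x, triangle q x -> v x 0 k = c k + dot (g k) x.

Lemma tri_integral_tgrad_dotv q c d g h v w : 0 < tri_area q ->
  affine_with q c g v -> affine_with q d h w ->
  tri_integral q (tgrad_dotv q v w) =
  m * (2 * tri_area q * \sum_k dot (tangent_proj q (g k)) (tangent_proj q (h k))).
Proof.
move=> A0 vE wE; apply: tri_integral_cst => s sP; apply: eq_bigr => k _.
by rewrite /tgrad_dot (tgrad_affine_on (vE k)) // (tgrad_affine_on (wE k)).
Qed.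

Lemma dot_tri_normal q : 0 < tri_area q ->
  dot (tri_normal q) (tri_normal q) = 1.
Proof.
move=> /enorm_tri_cross_gt0/lt0r_neq0 W0.
by rewrite /tri_normal dotZl dotZr -enorm_sqr; field.
Qed.

Lemma tangent_projP q p : 0 < tri_area q ->
  [/\ dot (tangent_proj q p) (tri_cross q) = 0,
      dot (tangent_proj q p) (q 1 - q 0) = dot p (q 1 - q 0) &
      dot (tangent_proj q p) (q 2 - q 0) = dot p (q 2 - q 0)].
Proof.
move=> /enorm_tri_cross_gt0/lt0r_neq0 W0.
split; rewrite /tangent_proj /tri_normal dotBl !dotZl ?dotZr.
- by rewrite -enorm_sqr; field.
- by rewrite (dotC (tri_cross q)) dot_cross_l !mulr0 subr0.
- by rewrite (dotC (tri_cross q)) dot_cross_r !mulr0 subr0.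
Qed.

Lemma vertex_triangle q j : triangle q (q j).
Proof.
exists (fun i => (i == j)%:R); split=> //.
- by rewrite (bigD1 j) //= eqxx big1 ?addr0 // => i /negbTE ->.
- rewrite (bigD1 j) //= eqxx scale1r big1 ?addr0 //.
  by move=> i /negbTE ->; rewrite scale0r.
Qed.

(** The sum is the squared norm of the gradient of [v]. By [gram_cross] it is a quadratic expression
    in the edges of the image triangle, which [cross_am_gm] bounds below by their cross product. *)
Lemma image_tri_area_le q c g v : 0 < tri_area q -> affine_with q c g v ->
  tri_area (v \o q) <= tri_area q / 2 *
    \sum_k dot (tangent_proj q (g k)) (tangent_proj q (g k)).
Proof.
move=> A0 vE; have W0 := enorm_tri_cross_gt0 A0.
set S := \sum_k _.
(* The linear part of [v] maps edges to edges of the image; [gram_cross] needs only these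
   products. *)
have vB i k : dot (g k) (q i - q 0) = (v (q i) - v (q 0)) 0 k.
  by rewrite !mxE !vE; [rewrite dotBr; ring|exact: vertex_triangle..].
have SE : S * enorm (tri_cross q) ^+ 2 =
    dot (q 2 - q 0) (q 2 - q 0) * dot (v (q 1) - v (q 0)) (v (q 1) - v (q 0))
    - 2 * dot (q 1 - q 0) (q 2 - q 0) * dot (v (q 1) - v (q 0)) (v (q 2) - v (q 0))
    + dot (q 1 - q 0) (q 1 - q 0) * dot (v (q 2) - v (q 0)) (v (q 2) - v (q 0)).
  rewrite enorm_sqr mulr_suml sum_ord3.
  have E k := let: And3 a b c := tangent_projP (g k) A0 in
    (gram_cross a, b, c).
  rewrite !{1}E !vB !(dotE (v _ - _)); ring.
have := cross_am_gm (v (q 1) - v (q 0)) (v (q 2) - v (q 0)) W0.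
rewrite -SE /tri_area -/(tri_cross (v \o q)) => H.
suff : 2 * enorm (tri_cross (v \o q)) <= S * enorm (tri_cross q) by lra.
by rewrite -(ler_pM2r W0); move: H; rewrite expr2; lra.
Qed.

(** The squared Frobenius norm of an orthogonal projection is its trace, here the dimension of the
    tangent plane. This makes the energy of the identity equal to the area. *)
Lemma sum_tangent_proj_delta q : 0 < tri_area q ->
  \sum_k dot (tangent_proj q (delta_mx 0 k)) (tangent_proj q (delta_mx 0 k)) = 2.
Proof.
rewrite /tangent_proj => /dot_tri_normal; move: (tri_normal q) => n n1.
have E (k : 'I_3) (d := delta_mx 0 k) :
    dot (d - dot d n *: n) (d - dot d n *: n) = 1 - n 0 k * n 0 k.
  rewrite dotBl !dotBr !dotZl !dotZr n1 (dotC n) !dot_delta.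
  by rewrite /d (dotC _ n) dot_delta mxE !eqxx /=; ring.
rewrite sum_ord3 !E; move: n1; rewrite dotE; lra.
Qed.

Lemma affine_flow_map q (tau : R) c g v : affine_with q c g v ->
  affine_with q (fun k => tau * c k) (fun k => delta_mx 0 k + tau *: g k)
    (flow_map tau v).
Proof.
move=> vE k x qx; rewrite !mxE vE // dotDl dotZl (dotC (delta_mx _ _)).
by rewrite dot_delta; ring.
Qed.

Lemma tri_area_energy_le q (tau : R) v : 0 < tri_area q ->
  (forall k, affine_on (triangle q) (fun x => v x 0 k)) ->
  m * (tri_area (flow_map tau v \o q) - tri_area q) <=
  tau / 2 * tri_integral q (tgrad_dotv q (flow_map tau v) v).
Proof.
move=> A0 /choice[c] /choice[g] vE.
have XE := affine_flow_map tau vE.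
rewrite (tri_integral_tgrad_dotv A0 XE vE) mulrCA ler_pM2l ?ref_triangle_measure_gt0 //.
apply: le_trans (lerB (image_tri_area_le A0 XE) (lexx _)) _.
set S1 := \sum_k _; set S2 := \sum_k _.
(* The 2 is the energy density of the identity; what remains is convexity of the squared norm. *)
suff : S1 - 2 <= 2 * tau * S2.
  by move=> H; have := ler_wpM2l (ltW A0) H; lra.
rewrite -[X in _ - X](sum_tangent_proj_delta A0) /S1 /S2 -sumrB mulr_sumr; apply: ler_sum => k _.
have PD a b : tangent_proj q (a + tau *: b) = tangent_proj q a + tau *: tangent_proj q b.
  rewrite /tangent_proj dotDl dotZl; apply/rowP => i; rewrite !mxE; ring.
rewrite PD; move: (tangent_proj q _) (tangent_proj q _) => p e.
rewrite !(dotDl, dotDr, dotZl, dotZr) (dotC e p).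
(* With gradients e of a coordinate and p of the velocity, 2 tau (e + tau p) . p exceeds |e + tau
   p|^2 - |e|^2 by exactly tau^2 |p|^2. *)
by have := mulr_ge0 (sqr_ge0 tau) (dot_ge0 p); lra.
Qed.

End Elements.

(** * Summation over the surface and testing of the schemes *)

Section Scheme.
Context {R : realType} (G : closed_surface R).

Lemma dirichletvC v w : dirichletv G v w = dirichletv G w v.
Proof.
apply: eq_bigr => K _; congr tri_integral; apply/funext => x.
by apply: eq_bigr => k _; rewrite /tgrad_dot dotC.
Qed.

(** Gives the sign of the velocity term for surface diffusion, as [lumped_sqr_ge0] does for mean
    curvature flow. *)
Lemma dirichlet_ge0 f : Sh G f -> 0 <= dirichlet G f f.
Proof.
move=> [_ fA]; apply: sumr_ge0 => K _; have [c [g fE]] := fA K.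
have A0 := surf_nondeg K.
rewrite (tri_integral_cst (r := dot (tangent_proj (vtx K) g) (tangent_proj (vtx K) g))).
  apply: mulr_ge0; first exact: ltW (ref_triangle_measure_gt0 R).
  by rewrite mulr_ge0 ?dot_ge0 // mulr_ge0 // ltW.
by move=> s sP; rewrite /tgrad_dot (tgrad_affine_on fE).
Qed.

Lemma lumped_sqr_ge0 (f : 'rV[R]_3 -> R) : 0 <= lumped (fun (K : cell G) x => f x * f x).
Proof.
apply: sumr_ge0 => K _; rewrite mulr_ge0 //.
  by rewrite divr_ge0 // ltW // surf_nondeg.
by apply: sumr_ge0 => j _; rewrite -expr2 sqr_ge0.
Qed.

Lemma lumped_normalC (f : 'rV[R]_3 -> R) (w : 'rV[R]_3 -> 'rV[R]_3) :
  lumped (fun K : cell G => fun x => dot (f x *: nrm K) (w x)) =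
  lumped (fun K : cell G => fun x => dot (w x) (nrm K) * f x).
Proof.
apply: eq_bigr => K _; congr (_ * _); apply: eq_bigr => j _.
by rewrite dotZl dotC mulrC.
Qed.

Lemma image_area_le (tau : R) v : Sh3 G v -> dirichletv G (flow_map tau v) v <= 0 ->
  0 < tau -> image_area G (flow_map tau v) <= surf_area G.
Proof.
move=> vS D0 tau0; rewrite -subr_le0 -(pmulr_rle0 _ (ref_triangle_measure_gt0 R)).
rewrite /image_area /surf_area -sumrB mulr_sumr.
apply: (@le_trans _ _ (tau / 2 * dirichletv G (flow_map tau v) v)); last first.
  by rewrite pmulr_rle0 // divr_gt0.
rewrite mulr_sumr; apply: ler_sum => K _; apply: tri_area_energy_le.
  exact: surf_nondeg.
by move=> k; exact: (vS k).2.
Qed.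

End Scheme.

Theorem theorem2p2 (R : realType) (tau : R) (tau_gt0 : 0 < tau)
    (G : closed_surface R)
    (v : 'rV[R]_3 -> 'rV[R]_3) (H : 'rV[R]_3 -> R)
    (lam : 'rV[R]_3 -> 'rV[R]_3) (kappa : 'rV[R]_3 -> R)
    (vS : Sh3 G v) (HS : Sh G H) (lamS : Sh3 G lam) (kappaS : Sh G kappa) :
  mcf_scheme G tau v H lam kappa \/ sd_scheme G tau v H lam kappa ->
  image_area G (flow_map tau v) <= surf_area G.
Proof.
move=> scheme; apply: image_area_le => //.
have [curv tang mult vel] : [/\ curvature_eq G tau v H lam,
    tangential_eq G v kappa, multiplier_eq G lam &
    lumped (fun K : cell G => fun x => dot (v x) (nrm K) * H x) <= 0].
  (* Only this sign depends on the scheme: testing with [H] turns the velocity term into minus a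
     square. *)
  case: scheme => -[curv vel tang mult]; split=> //.
    by have := vel H HS; have := lumped_sqr_ge0 G H; lra.
  by have := vel H HS; have := dirichlet_ge0 HS; lra.
have := curv v vS; rewrite (dirichletvC _ lam) (tang lam lamS).
by rewrite !lumped_normalC (mult kappa kappaS); lra.
Qed.
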